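(* Let $d\ge 2$ be an integer, $\lambda>0$, and let $\kappa$ be a nonnegative integer. For each integer $\ell\ge 0$ let $\{Y_\nu^{\ell}:1\le\nu\le a_\ell^d\}$ be an orthonormal basis of $\mathcal{H}_\ell^d$. For every $n\ge 0$ and $0\le j\le \lfloor n/2\rfloor$ let $q_j=q_j^{(\beta)}$, with $\beta=n-2j+\frac{d-2}{2}$, be a univariate real polynomial of degree exactly $j$ (it may depend on $j$ and on $n-2j$), and put $$R_{j,\nu}^{n}(x)=q_j(2\|x\|^2-1)\,Y_\nu^{n-2j}(x),\qquad 1\le \nu\le a_{n-2j}^d .$$ Suppose that the system $\{R_{j,\nu}^{n}: n\ge 0,\ 0\le j\le\lfloor n/2\rfloor,\ 1\le\nu\le a_{n-2j}^d\}$ is a basis (of the space of polynomials in $d$ variables) which is mutually orthogonal with respect to the inner product $\langle\cdot,\cdot\rangle_S$. Then, for each value $\beta=\ell+\frac{d-2}{2}$ with $\ell\ge 0$ an integer (where $\ell=n-2j$), the polynomials $\{q_j^{(\beta)}\}_{j\ge 0}$ are orthogonal with respect to the univariate Sobolev inner product $$(f,g)_\beta=\frac{\lambda}{2^{\kappa+3}}\int_{-1}^1 f(t)g(t)(1-t)^{\kappa+2}(1+t)^{\beta}\,dt+\int_{-1}^1\frac{d}{dt}\big((1-t)f(t)\big)\,\frac{d}{dt}\big((1-t)g(t)\big)\,(1+t)^{\beta+1}\,dt ,$$ that is, $(q_j^{(\beta)},q_k^{(\beta)})_\beta=0$ whenever $j\ne k$.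
   Context: $\mathbb{B}^d=\{x\in\mathbb{R}^d:\|x\|\le 1\}$ and $\mathbb{S}^{d-1}=\{\xi\in\mathbb{R}^d:\|\xi\|=1\}$, with $\|\cdot\|$ the Euclidean norm. $\mathcal{H}_\ell^d$ is the space of homogeneous polynomials $Y$ of degree $\ell$ in $d$ real variables with $\Delta Y=0$, and $a_\ell^d=\dim\mathcal{H}_\ell^d$. Orthonormality of a basis of $\mathcal{H}_\ell^d$ is understood with respect to $\langle f,g\rangle_{\mathbb{S}^{d-1}}=\frac{1}{\omega_d}\int_{\mathbb{S}^{d-1}}f(\xi)g(\xi)\,d\sigma(\xi)$, where $d\sigma$ is surface measure and $\omega_d$ is the surface area of $\mathbb{S}^{d-1}$. The inner product $\langle\cdot,\cdot\rangle_S$ on real polynomials in $d$ variables is $$\langle u,v\rangle_S=\lambda\int_{\mathbb{B}^d}(1-\|x\|^2)^{\kappa+2}u(x)v(x)\,dx+\int_{\mathbb{B}^d}\nabla\big((1-\|x\|^2)u(x)\big)\cdot\nabla\big((1-\|x\|^2)v(x)\big)\,dx .$$ A family is mutually orthogonal if any two distinct members have zero inner product. *)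

(* Defs.v *)
From HB Require Import structures.
From mathcomp Require Import all_boot all_order all_algebra.
(* The notations of mpoly clash with those of MathComp-Analysis. *)
From mathcomp Require Import -(notations) mpoly.
From mathcomp Require Import all_classical all_reals all_analysis.
From mathcomp Require Import measurable_realfun.

Set Implicit Arguments.
Unset Strict Implicit.
Unset Printing Implicit Defensive.

Import Order.TTheory GRing.Theory Num.Theory.
Import numFieldNormedType.Exports.

Local Open Scope classical_set_scope.
Local Open Scope ring_scope.

Notation "{ 'mpoly' T [ n ] }" := (mpoly n T) : type_scope.

Section Basis.
Context {K : pzRingType} {V : lmodType K}.

(* Algebraic (Hamel) basis of the subspace A; I may be infinite. *)
Definition is_basis {I : eqType} (A : set V) (b : I -> V) : Prop :=
  [/\ forall i, A (b i),
      forall (s : seq I) (c : I -> K), uniq s ->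
        \sum_(i <- s) c i *: b i = 0 -> {in s, forall i, c i = 0}
    & forall v, A v -> exists (s : seq I) (c : I -> K),
        v = \sum_(i <- s) c i *: b i].

Definition has_dim (A : set V) (m : nat) : Prop :=
  exists b : 'I_m -> V, is_basis A b.

Definition mutually_orthogonal {I : eqType} (ip : V -> V -> K) (b : I -> V) :
    Prop :=
  forall i j, i != j -> ip (b i) (b j) = 0.

Definition orthonormal_family {I : eqType} (ip : V -> V -> K) (b : I -> V) :
    Prop :=
  mutually_orthogonal ip b /\ forall i, ip (b i) (b i) = 1.

End Basis.

(* The canonical sigma-finite structure on m1 \x m2 is masked by the one for
   finite measures, hence this restatement. *)
Lemma product_sigma_finite d1 d2 (T1 : measurableType d1)
    (T2 : measurableType d2) (R : realType)
    (m1 : {sigma_finite_measure set T1 -> \bar R})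
    (m2 : {sigma_finite_measure set T2 -> \bar R}) :
  sigma_finite [set: T1 * T2] (m1 \x m2)%E.
Proof.
have /sigma_finiteP[F [TF ndF Foo]] := sigma_finiteT m1.
have /sigma_finiteP[G [TG ndG Goo]] := sigma_finiteT m2.
exists (fun n => F n `*` G n).
  rewrite -setXTT TF TG predeqE => -[x y]; split.
    move=> [/= [n _ Fnx] [k _ Gky]]; exists (maxn n k) => //; split.
    - by move: x Fnx; exact/subsetPset/ndF/leq_maxl.
    - by move: y Gky; exact/subsetPset/ndG/leq_maxr.
  by move=> [n _ []/= ? ?]; split; exists n.
move=> k; have [? ?] := Foo k; have [? ?] := Goo k.
split; first exact: measurableX.
by rewrite product_measure1E// lte_mul_pinfty// ge0_fin_numE.
Qed.

Section PushforwardIso.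
Local Open Scope ereal_scope.
Context d1 d2 (T1 : measurableType d1) (T2 : measurableType d2) (R : realType).
Variables (m : {measure set T1 -> \bar R}).
Variables (f : T1 -> T2) (g : T2 -> T1).
Hypotheses (mf : measurable_fun [set: T1] f) (mg : measurable_fun [set: T2] g).
Hypotheses (fK : cancel f g) (sfm : sigma_finite [set: T1] m).

Definition mpush : set T2 -> \bar R := pushforward m f.

HB.instance Definition _ := Measure.copy mpush
  (measure_function_pushforward__canonical__measure_function_Measure m mf).

Let mpush_sigma_finite : sigma_finite [set: T2] mpush.
Proof.
have [F TF mF] := sfm.
exists (fun n => g @^-1` F n).
  by rewrite -preimage_bigcup -TF preimage_setT.
move=> n; have [mFn Fnoo] := mF n; split.
  by rewrite -[X in measurable X]setTI; exact: mg.
rewrite /mpush /pushforward -comp_preimage (_ : g \o f = id) //.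
exact/funext.
Qed.

HB.instance Definition _ :=
  Measure_isSigmaFinite.Build _ _ _ mpush mpush_sigma_finite.

Lemma pushforward_iso_sigma_finite :
  exists mu : {sigma_finite_measure set T2 -> \bar R}, pushforward m f = mu.
Proof. by exists mpush. Qed.

End PushforwardIso.

Section Euclidean.
Variable R : realType.
Notation vec n := (n.-tuple (measurableTypeR R)).

Definition consv n (xt : measurableTypeR R * vec n) : vec n.+1 :=
  [tuple of xt.1 :: xt.2].

Fixpoint lebesgue_tuple (n : nat) : set (vec n) -> \bar R :=
  match n with
  | 0%N => \d_([tuple] : vec 0)
  | n'.+1 => pushforward (lebesgue_measure \x @lebesgue_tuple n')%E (@consv n')
  end.
Arguments lebesgue_tuple n _%_classical_set_scope : clear implicits.

Lemma measurable_consv n :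
  measurable_fun [set: (measurableTypeR R * vec n)%type] (@consv n).
Proof. by apply: measurable_cons. Qed.

Lemma measurable_unconsv n :
  measurable_fun [set: vec n.+1] (fun x => (thead x, [tuple of behead x])).
Proof.
apply/measurable_fun_pairP; split; first exact: measurable_tnth.
exact: measurable_behead.
Qed.

Let lebesgue_tuple_ex n :
  exists mu : {sigma_finite_measure set (vec n) -> \bar R},
    lebesgue_tuple n = mu.
Proof.
elim: n => [|n [mu IHn]].
  by exists (dirac ([tuple] : vec 0)).
rewrite /= IHn.
apply: (pushforward_iso_sigma_finite
  (@measurable_consv n) (@measurable_unconsv n)).
- by move=> [x t]; congr pair; apply/val_inj.
exact: product_sigma_finite.
Qed.

Let lebesgue_tuple0 n : lebesgue_tuple n set0 = 0%E.
Proof. by have [mu ->] := lebesgue_tuple_ex n; rewrite measure0. Qed.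

Let lebesgue_tuple_ge0 n A : (0 <= lebesgue_tuple n A)%E.
Proof. by have [mu ->] := lebesgue_tuple_ex n. Qed.

Let lebesgue_tuple_sigma_additive n : semi_sigma_additive (lebesgue_tuple n).
Proof.
have [mu ->] := lebesgue_tuple_ex n; exact: measure_semi_sigma_additive.
Qed.

HB.instance Definition _ n := isMeasure.Build _ _ _ (lebesgue_tuple n)
  (@lebesgue_tuple0 n) (@lebesgue_tuple_ge0 n)
  (@lebesgue_tuple_sigma_additive n).

Let lebesgue_tuple_sigma_finite n : sigma_finite setT (lebesgue_tuple n).
Proof. by have [mu ->] := lebesgue_tuple_ex n; exact: sigma_finiteT. Qed.

HB.instance Definition _ n := Measure_isSigmaFinite.Build _ _ _
  (lebesgue_tuple n) (@lebesgue_tuple_sigma_finite n).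

Definition enorm n (x : vec n) : R := Num.sqrt (\sum_(i < n) tnth x i ^+ 2).

Definition eball n : set (vec n) := [set x | enorm x <= 1].

Definition esphere n : set (vec n) := [set x | enorm x = 1].

Definition radial n (x : vec n) : vec n :=
  [tuple (enorm x)^-1 * tnth x i | i < n].

(* Polar coordinates: the surface measure of a part A of the unit sphere is n
   times the volume of the cone {r x | x in A, 0 < r <= 1}. *)
Definition surface_measure n (A : set (vec n)) : \bar R :=
  (n%:R%:E * lebesgue_tuple n
     [set x | (0 < enorm x <= 1)%R /\ A (radial x)])%E.

Lemma measurable_enorm n : measurable_fun [set: vec n] (@enorm n).
Proof.
apply: (@measurableT_comp _ _ _ _ _ _ (@Num.sqrt R)).
  by apply: continuous_measurable_fun; exact: sqrt_continuous.
apply: measurable_sum => i; apply: measurable_funX; exact: measurable_tnth.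
Qed.

Lemma measurable_radial n : measurable_fun [set: vec n] (@radial n).
Proof.
apply/measurable_fun_tnthP => i.
rewrite (_ : _ \o _ = (fun x => enorm x `^ (-1) * tnth x i)); last first.
  by apply/funext => x; rewrite /= tnth_mktuple powR_inv1// sqrtr_ge0.
apply: measurable_funM; last exact: measurable_tnth.
by apply: (@measurableT_comp _ _ _ _ _ _ (@powR R ^~ (-1)));
  [exact: measurable_powR|exact: measurable_enorm].
Qed.

Lemma measurable_punctured n : measurable [set x : vec n | 0 < enorm x <= 1].
Proof.
rewrite -[X in measurable X]setTI.
rewrite (_ : [set x | _] = @enorm n @^-1` `]0, 1]%classic); last first.
  by apply/seteqP; split=> x /=; rewrite in_itv.
exact: measurable_enorm.
Qed.

Let surface_measure_ex n :
  exists mu : {measure set (vec n) -> \bar R}, @surface_measure n = mu.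
Proof.
exists (mscale n%:R%:nng
  (measure_function_pushforward__canonical__measure_function_Measure
    (mrestr (lebesgue_tuple n) (@measurable_punctured n))
    (@measurable_radial n))).
apply/funext => A; rewrite /mscale /= /pushforward /mrestr.
by congr (_ * lebesgue_tuple n _)%E; apply/seteqP; split=> x [].
Qed.

Let surface_measure0 n : @surface_measure n set0 = 0%E.
Proof. by have [mu ->] := surface_measure_ex n; rewrite measure0. Qed.

Let surface_measure_ge0 n A : (0 <= @surface_measure n A)%E.
Proof. by have [mu ->] := surface_measure_ex n. Qed.

Let surface_measure_sigma_additive n :
  semi_sigma_additive (@surface_measure n).
Proof.
have [mu ->] := surface_measure_ex n; exact: measure_semi_sigma_additive.
Qed.

HB.instance Definition _ n := isMeasure.Build _ _ _ (@surface_measure n)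
  (@surface_measure0 n) (@surface_measure_ge0 n)
  (@surface_measure_sigma_additive n).

End Euclidean.

Arguments lebesgue_tuple R n _%_classical_set_scope : clear implicits.
Arguments surface_measure R n _%_classical_set_scope : clear implicits.
Arguments eball R n _ : clear implicits.
Arguments esphere R n _ : clear implicits.

Section Polynomials.
Context {R : realType} {d : nat}.
Implicit Types (u v p : {mpoly R[d]}) (x : d.-tuple (measurableTypeR R)).

Definition peval p x : R := meval (tnth x) p.

Definition sqnormX : {mpoly R[d]} := \sum_(i < d) mpolyX R (mnm1 i) ^+ 2.

Definition laplacian p : {mpoly R[d]} := \sum_(i < d) mderiv i (mderiv i p).

Definition grad_dot u v x : R :=
  \sum_(i < d) peval (mderiv i u) x * peval (mderiv i v) x.

Definition homog_harmonic (l : nat) : set {mpoly R[d]} :=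
  [set p | p \is @ishomog1 d R l mdeg /\ laplacian p = 0].

Definition sphere_area : R := fine (surface_measure R d (esphere R d)).

Definition sphere_ip u v : R :=
  sphere_area^-1 * \int[surface_measure R d]_(x in esphere R d)
    (peval u x * peval v x).

Definition sobolev_ball (lambda : R) (kappa : nat) u v : R :=
  lambda * \int[lebesgue_tuple R d]_(x in eball R d)
    ((1 - enorm x ^+ 2) ^+ (kappa + 2) * peval u x * peval v x)
  + \int[lebesgue_tuple R d]_(x in eball R d)
    grad_dot ((1 - sqnormX) * u) ((1 - sqnormX) * v) x.

Section System.
Variables (a : nat -> nat) (Y : forall l, 'I_(a l) -> {mpoly R[d]}).
Variable q : nat -> nat -> {poly R}.

(* Triples (n, j, nu) with j <= n/2 and nu ranging over a_(n-2j) values. *)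
Definition sysidx : eqType :=
  {n : nat & {j : 'I_(n./2).+1 & 'I_(a (n - j.*2))}}.

(* q_j(2||x||^2 - 1) Y_nu^(n-2j)(x), where q l j stands for q_j^(beta) with
   beta = l + (d-2)/2. *)
Definition Rpoly (n j : nat) (nu : 'I_(a (n - j.*2))) : {mpoly R[d]} :=
  horner_alg (2 *: sqnormX - 1) (q (n - j.*2) j) * Y nu.

Definition Rsystem (i : sysidx) : {mpoly R[d]} :=
  Rpoly (tagged (tagged i)).

End System.

End Polynomials.

Section Univariate.
Context {R : realType}.

Definition beta (d l : nat) : R := l%:R + (d%:R - 2) / 2.

Definition sobolev_interval (lambda : R) (kappa : nat) (b : R)
    (f g : {poly R}) : R :=
  lambda / 2 ^+ (kappa + 3) * \int[@lebesgue_measure R]_(t in `[-1, 1])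
    (f.[t] * g.[t] * (1 - t) ^+ (kappa + 2) * (1 + t) `^ b)
  + \int[@lebesgue_measure R]_(t in `[-1, 1])
    (((1 - 'X) * f)^`().[t] * ((1 - 'X) * g)^`().[t] * (1 + t) `^ (b + 1)).

End Univariate.

(* Main.v *)
Require Import Defs.
From HB Require Import structures.
From mathcomp Require Import all_boot all_order all_algebra.
From mathcomp Require Import -(notations) mpoly.
From mathcomp Require Import all_classical all_reals all_analysis.
From mathcomp Require Import measurable_realfun ring lra.

(* No polar coordinates are needed. By Fubini and the fundamental theorem of
   calculus, the divergence of a polynomial field that vanishes on the unit
   sphere integrates to 0 over the ball. Applied to F(T) G(T) Y grad Y, with
   T = 2|x|^2 - 1 and Y harmonic, this removes |grad Y|^2 from the inner product
   of q_j(T) Y and q_k(T) Y, which becomes the integral of h(T) Y^2 for an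
   explicit univariate polynomial h. Applied to the radial fields
   x Y^2 (|x|^(2m) - 1), it shows that, as a function of h, this integral is
   proportional to the integral of h(t) (1 + t)^beta over [-1, 1]. For the h at
   hand the latter is twice (q_j, q_k)_beta, and the factor is nonzero because Y
   does not vanish almost everywhere. *)

Set Implicit Arguments.
Unset Strict Implicit.
Unset Printing Implicit Defensive.

Import Order.TTheory GRing.Theory Num.Theory.
Import numFieldNormedType.Exports.
Local Open Scope classical_set_scope.
Local Open Scope ring_scope.

(** * Integration over Euclidean balls by slicing *)

Section DivergenceOnBall.
Context {R : realType}.
Local Notation vec n := (n.-tuple (measurableTypeR R)).
Local Notation leb := (@lebesgue_measure R).

Definition sqn n (x : vec n) : R := \sum_(i < n) tnth x i ^+ 2.

(* c is the squared radius. *)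
Definition ballc n (c : R) : set (vec n) := [set x | sqn x <= c].

Arguments ballc n c _ : clear implicits.

(** As [t] varies this runs along the line through [x] parallel to axis [i], where a partial
    derivative is an ordinary one. *)
Definition upd n (x : vec n) (i : 'I_n) (t : R) : vec n :=
  [tuple if j == i then t else tnth x j | j < n].

Lemma sqn_cons n (t : R) (x : vec n) : sqn (consv (t, x)) = t ^+ 2 + sqn x.
Proof.
rewrite /sqn big_ord_recl; congr (_ + _).
by apply: eq_bigr => i _; rewrite tnthS.
Qed.

Lemma sqn_ge0 n (x : vec n) : 0 <= sqn x.
Proof. by apply: sumr_ge0 => i _; exact: sqr_ge0. Qed.

Lemma upd_cons0 n (t s : R) (x : vec n) :
  upd (consv (t, x)) ord0 s = consv (s, x).
Proof.
apply: eq_from_tnth => j; rewrite tnth_mktuple.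
by case: (unliftP ord0 j) => [k|] ->; rewrite ?eqxx//= !tnthS.
Qed.

Lemma upd_consS n (i : 'I_n) (t s : R) (x : vec n) :
  upd (consv (t, x)) (lift ord0 i) s = consv (t, upd x i s).
Proof.
apply: eq_from_tnth => j; rewrite tnth_mktuple.
case: (unliftP ord0 j) => [k|] -> //=; rewrite !tnthS.
by rewrite (inj_eq lift_inj) tnth_mktuple.
Qed.

Lemma measurable_sqn n : measurable_fun [set: vec n] (@sqn n).
Proof.
by apply: measurable_sum => i; apply: measurable_funX; exact: measurable_tnth.
Qed.

Lemma measurable_ballc n c : measurable (ballc n c).
Proof.
rewrite -[X in measurable X]setTI.
rewrite (_ : ballc n c = @sqn n @^-1` `]-oo, c]%classic); last first.
  by apply/seteqP; split=> x /=; rewrite in_itv.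
exact: measurable_sqn.
Qed.

Lemma measurable_consvT d' (T : measurableType d') n (f : vec n.+1 -> T) (t : R) :
  measurable_fun setT f -> measurable_fun setT (fun x : vec n => f (consv (t, x))).
Proof.
move=> mf; apply: (measurableT_comp (f := f) mf).
apply: (measurableT_comp (@measurable_consv R n)).
exact: measurable_pair1.
Qed.

(** The ball lies in the product of a segment and a ball of one dimension less with the same [c]. *)
Lemma ballc_fin n c : (lebesgue_tuple R n (ballc n c) < +oo)%E.
Proof.
elim: n c => [|n IHn] c.
  by rewrite /= diracE ltry.
rewrite /= /pushforward.
set s : R := Num.sqrt `|c|.
have ssfin : (leb `[(- s)%R, s]%classic < +oo)%E.
  by rewrite lebesgue_measure_itv; case: ifP; rewrite ?ltry.
apply: (@le_lt_trans _ _
  ((lebesgue_measure \x lebesgue_tuple R n)%E (`[- s, s]%classic `*` ballc n c))).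
  apply: le_measure; rewrite ?inE.
  - rewrite -[X in measurable X]setTI; apply: measurable_consv => //.
    exact: measurable_ballc.
  - by apply: measurableX => //; exact: measurable_ballc.
  move=> [t x]; rewrite /ballc /= sqn_cons in_itv /= -ler_norml => h.
  have t2 := sqr_ge0 t; have x2 := sqn_ge0 x; split; last lra.
  rewrite -sqrtr_sqr; apply: ler_wsqrtr; apply: le_trans (ler_norm _); lra.
rewrite product_measure1E //; last exact: measurable_ballc.
apply: lte_mul_pinfty => //; last exact: IHn.
rewrite ge0_fin_numE //; exact: ssfin.
Qed.

Lemma integrable_ballc n c (g : vec n -> R) M :
  measurable_fun setT g -> (forall x, sqn x <= c -> `|g x| <= M) ->
  (lebesgue_tuple R n).-integrable (ballc n c) (EFin \o g).
Proof.
move=> mg gM; apply: measurable_bounded_integrable.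
- exact: measurable_ballc.
- exact: ballc_fin.
- exact: measurable_funTS.
exists M; split; first exact: num_real.
by move=> N /ltW MN x /gM /le_trans; exact.
Qed.

Section Fubini.
Variables (n : nat) (c : R) (g : vec n.+1 -> R) (M : R).
Hypothesis mg : measurable_fun setT g.
Hypothesis gM : forall x, sqn x <= c -> `|g x| <= M.

Let D : set (measurableTypeR R * vec n) := @consv R n @^-1` ballc n.+1 c.

Let mD : measurable D.
Proof.
rewrite -[X in measurable X]setTI; apply: measurable_consv => //.
exact: measurable_ballc.
Qed.

Let ig : (leb \x lebesgue_tuple R n)%E.-integrable D (EFin \o g \o @consv R n).
Proof.
apply: (@measurable_bounded_integrable _ _ _ _ (g \o @consv R n)) => //.
- exact: (@ballc_fin n.+1 c).
- apply: measurable_funTS; apply: (measurableT_comp mg).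
  exact: measurable_consv.
exists M; split; first exact: num_real.
by move=> N /ltW MN x /gM /le_trans; exact.
Qed.

Let integral_consv : (\int[lebesgue_tuple R n.+1]_(x in ballc n.+1 c) (g x)%:E =
  \int[leb \x lebesgue_tuple R n]_z ((EFin \o g \o @consv R n) \_ D) z)%E.
Proof.
rewrite -integral_mkcond.
rewrite (eq_measure_integral (measure_function_pushforward__canonical__measure_function_Measure
    (leb \x lebesgue_tuple R n)%E (@measurable_consv R n))) //=.
apply: integral_pushforward => //; last exact: measurable_ballc.
  exact: measurable_consv.
exact/measurable_EFinP.
Qed.

Let igD : (leb \x lebesgue_tuple R n)%E.-integrable setT
  ((EFin \o g \o @consv R n) \_ D).
Proof. by apply: (integrable_restrict _ _ _ _).1 => //; rewrite setTI. Qed.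

(** The slice at first coordinate [t] is again a ball. This order of integration serves the
    induction on the dimension; the reverse order, in [fubini_ballc2], leaves chords for the
    fundamental theorem of calculus. *)
Lemma fubini_ballc1 :
  (\int[lebesgue_tuple R n.+1]_(x in ballc n.+1 c) (g x)%:E =
   \int[leb]_t \int[lebesgue_tuple R n]_(x in ballc n (c - t ^+ 2))
     (g (consv (t, x)))%:E)%E.
Proof.
rewrite integral_consv -integral12_prod_meas1 //.
apply: eq_integral => t _; rewrite [RHS]integral_mkcond.
apply: eq_integral => x _; rewrite /patch /=.
congr (if _ then _ else _).
by apply/idP/idP => /set_mem h; apply/mem_set; move: h;
  rewrite /D /ballc /= sqn_cons; lra.
Qed.

Lemma fubini_ballc2 :
  (\int[lebesgue_tuple R n.+1]_(x in ballc n.+1 c) (g x)%:E =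
   \int[lebesgue_tuple R n]_x \int[leb]_(t in [set t | (t ^+ 2 <= c - sqn x)%R])
     (g (consv (t, x)))%:E)%E.
Proof.
rewrite integral_consv -integral21_prod_meas1 //.
apply: eq_integral => t _; rewrite [RHS]integral_mkcond.
apply: eq_integral => x _; rewrite /patch /=.
congr (if _ then _ else _).
by apply/idP/idP => /set_mem h; apply/mem_set; move: h;
  rewrite /D /ballc /= sqn_cons; lra.
Qed.

End Fubini.

Lemma integral_deriv_horner (P : {poly R}) (a b : R) : a < b ->
  (\int[leb]_(t in `[a, b]) (P^`().[t])%:E = (P.[b] - P.[a])%:E)%E.
Proof.
move=> ab; rewrite (@continuous_FTC2 _ (horner P^`()) (horner P)) //.
- by apply: continuous_subspaceT => x; exact: continuous_horner.
- split.
  + by move=> x _; exact: derivable_horner.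
  + by apply: cvg_at_right_filter; exact: continuous_horner.
  + by apply: cvg_at_left_filter; exact: continuous_horner.
by move=> x _; rewrite -derivE.
Qed.

(** The domain is empty, a point or a segment according to the sign of [c]; the endpoints of the
    segment are roots of [P]. *)
Lemma integral_sqr_le (c : R) (P : {poly R}) :
  (forall t, t ^+ 2 = c -> P.[t] = 0) ->
  (\int[leb]_(t in [set t | (t ^+ 2 <= c)%R]) (P^`().[t])%:E = 0)%E.
Proof.
move=> P0; have [c0|c0|c0] := ltgtP c 0.
- rewrite (_ : [set _ | _] = set0) ?integral_set0 //.
  apply/seteqP; split=> t //=; have := sqr_ge0 t; lra.
- have s0 : 0 < Num.sqrt c by rewrite sqrtr_gt0.
  have sc : Num.sqrt c ^+ 2 = c by rewrite sqr_sqrtr // ltW.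
  rewrite (_ : [set _ | _] = `[- Num.sqrt c, Num.sqrt c]%classic); last first.
    apply/seteqP; split=> t /=;
      by rewrite in_itv /= -ler_norml -sqrtr_sqr ler_sqrt // ltW.
  rewrite integral_deriv_horner; last lra.
  by rewrite !P0 ?sqrrN // subrr.
- rewrite c0 (_ : [set _ | _] = [set 0]) ?integral_set1 //.
  apply/seteqP; split=> t /=; last by move=> ->; rewrite expr0n.
  by move=> t0; apply/eqP; rewrite -sqrf_eq0 eq_le t0 sqr_ge0.
Qed.

(* The coordinate i is integrated innermost: peel off the other coordinates by
   Fubini, the squared radius c dropping to c - t ^+ 2, then apply the
   fundamental theorem of calculus on a chord, whose endpoints lie on the
   sphere. *)
Lemma integral_ballc_deriv n (i : 'I_n) c (f g : vec n -> R) M :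
  measurable_fun setT g -> (forall x, sqn x <= c -> `|g x| <= M) ->
  (forall x, exists P : {poly R},
     forall t, f (upd x i t) = P.[t] /\ g (upd x i t) = P^`().[t]) ->
  (forall x, sqn x = c -> f x = 0) ->
  (\int[lebesgue_tuple R n]_(x in ballc n c) (g x)%:E = 0)%E.
Proof.
elim: n i c f g => [[]//|n IHn] i c f g mg gM fg f0.
case: (unliftP ord0 i) fg => [j|] -> fg; last first.
  rewrite (fubini_ballc2 mg gM); apply: integral0_eq => x _.
  (* The coordinate [0] is a placeholder that [upd] overwrites. *)
  have [P fgP] := fg (consv (0, x)).
  rewrite -[RHS](@integral_sqr_le (c - sqn x) P).
    by apply: eq_integral => t _; rewrite -(fgP t).2 upd_cons0.
  by move=> t tc; rewrite -(fgP t).1 upd_cons0 f0 // sqn_cons tc subrK.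
rewrite (fubini_ballc1 mg gM); apply: integral0_eq => t _.
apply: (IHn j _ (fun x => f (consv (t, x)))).
- exact: measurable_consvT.
- by move=> x xc; apply: gM; rewrite sqn_cons; lra.
- move=> x; have [P fgP] := fg (consv (t, x)); exists P => s.
  by rewrite -upd_consS.
- by move=> x xc; apply: f0; rewrite sqn_cons xc; lra.
Qed.

End DivergenceOnBall.

Arguments ballc {R} n c _.

(** * Polynomials in several variables and their integrals over the unit ball *)

Section PolynomialCalculus.
Context {R : realType} {d : nat}.
Implicit Types (p q : {mpoly R[d]}) (x : d.-tuple (measurableTypeR R)).
Local Notation Xm i := (mpolyX R (mnm1 i)).
Local Notation S := (@sqnormX R d).
Local Notation "l .-homog" := (@ishomog1 d R l mdeg) (at level 1).

(** Reduces facts about evaluation and derivation to the generators of the polynomial algebra. *)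
Lemma mpoly_alg_ind (Q : {mpoly R[d]} -> Prop) :
  Q 1 -> (forall i, Q (Xm i)) -> (forall p q, Q p -> Q q -> Q (p + q)) ->
  (forall p q, Q p -> Q q -> Q (p * q)) ->
  (forall c p, Q p -> Q (c *: p)) -> forall p, Q p.
Proof.
move=> Q1 QX QD QM QZ; elim/mpolyind => [|c m p _ _ Qp].
  by rewrite -(scale0r 1); exact: QZ.
apply: QD => //; apply: QZ; rewrite mpolyXE_id.
apply: big_ind => // i _; elim: (m i) => [|k IHk]; first by rewrite expr0.
by rewrite exprS; exact: QM.
Qed.

Lemma pevalD p q x : peval (p + q) x = peval p x + peval q x.
Proof. exact: mevalD. Qed.

Lemma pevalB p q x : peval (p - q) x = peval p x - peval q x.
Proof. exact: mevalB. Qed.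

Lemma pevalM p q x : peval (p * q) x = peval p x * peval q x.
Proof. exact: mevalM. Qed.

Lemma pevalZ c p x : peval (c *: p) x = c * peval p x.
Proof. exact: mevalZ. Qed.

Lemma peval0 x : peval 0 x = 0 :> R.
Proof. exact: meval0. Qed.

Lemma peval1 x : peval 1 x = 1 :> R.
Proof. exact: meval1. Qed.

Lemma pevalX i x : peval (Xm i) x = tnth x i :> R.
Proof. exact: mevalXU. Qed.

Lemma peval_exp p n x : peval (p ^+ n) x = peval p x ^+ n.
Proof. by rewrite /peval rmorphXn. Qed.

Lemma peval_sum I (r : seq I) (P : pred I) (F : I -> {mpoly R[d]}) x :
  peval (\sum_(i <- r | P i) F i) x = \sum_(i <- r | P i) peval (F i) x.
Proof. by rewrite /peval raddf_sum. Qed.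

Lemma peval_sqnormX x : peval S x = sqn x.
Proof.
by rewrite peval_sum; apply: eq_bigr => i _; rewrite peval_exp pevalX.
Qed.

Lemma enorm_sqr x : enorm x ^+ 2 = sqn x.
Proof. by rewrite sqr_sqrtr // sqn_ge0. Qed.

Lemma eballE : eball R d = ballc d 1.
Proof.
apply/seteqP; split=> x; rewrite /eball /ballc /= -enorm_sqr => x1.
  by rewrite expr_le1 // sqrtr_ge0.
by rewrite -(@expr_le1 _ 2) // sqrtr_ge0.
Qed.

Lemma measurable_peval p : measurable_fun setT (peval p).
Proof.
elim/mpoly_alg_ind: p => [|i|p q mp mq|p q mp mq|c p mp].
- by rewrite (_ : peval _ = cst 1) //; apply/funext => x; rewrite peval1.
- rewrite (_ : peval _ = (@tnth _ _)^~ i); first exact: measurable_tnth.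
  by apply/funext => x; rewrite pevalX.
- rewrite (_ : peval _ = peval p \+ peval q); first exact: measurable_funD.
  by apply/funext => x; rewrite pevalD.
- rewrite (_ : peval _ = peval p \* peval q); first exact: measurable_funM.
  by apply/funext => x; rewrite pevalM.
- rewrite (_ : peval _ = cst c \* peval p); first exact: measurable_funM.
  by apply/funext => x; rewrite pevalZ.
Qed.

Lemma peval_ball_bounded p :
  exists M, forall x, sqn x <= 1 -> `|peval p x| <= M.
Proof.
elim/mpoly_alg_ind: p => [|i|p q [M pM] [N qN]|p q [M pM] [N qN]|c p [M pM]].
- by exists 1 => x _; rewrite peval1 normr1.
- exists 1 => x x1; rewrite pevalX -(@expr_le1 _ 2) // real_normK ?num_real //.
  apply: le_trans x1; rewrite /sqn (bigD1 i) //= lerDl.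
  by apply: sumr_ge0 => j _; exact: sqr_ge0.
- exists (M + N) => x x1; rewrite pevalD.
  by apply: le_trans (ler_normD _ _) _; apply: lerD; [exact: pM|exact: qN].
- exists (M * N) => x x1; rewrite pevalM normrM.
  by apply: ler_pM => //; [exact: pM|exact: qN].
- exists (`|c| * M) => x x1; rewrite pevalZ normrM.
  by apply: ler_wpM2l => //; exact: pM.
Qed.

Lemma mderiv1 i : mderiv i (1 : {mpoly R[d]}) = 0.
Proof. exact: mderivC. Qed.

Lemma mderivXU (i j : 'I_d) : mderiv i (Xm j) = (i == j)%:R :> {mpoly R[d]}.
Proof.
rewrite mderivX mnm1E eq_sym; case: eqVneq => [->|_]; last by rewrite scale0r.
rewrite scale1r (_ : mnm_sub _ _ = mnm0) ?mpolyX0 //.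
by apply/mnmP => k; rewrite mnmBE subnn mnm0E.
Qed.

(** Matches the hypothesis of [integral_ballc_deriv], which wants a single [P] for a function and
    its derivative. *)
Lemma peval_line p x i : exists P : {poly R}, forall t,
  peval p (upd x i t) = P.[t] /\ peval (mderiv i p) (upd x i t) = P^`().[t].
Proof.
elim/mpoly_alg_ind: p => [|j|p q [P pP] [Q qQ]|p q [P pP] [Q qQ]|c p [P pP]].
- by exists 1 => t; rewrite mderiv1 peval0 peval1 derivC !hornerE.
- exists (if j == i then 'X else (tnth x j)%:P) => t.
  rewrite mderivXU pevalX tnth_mktuple eq_sym; case: eqVneq => _.
    by rewrite peval1 derivX !hornerE.
  by rewrite peval0 derivC !hornerE.
- exists (P + Q) => t; have [p1 p2] := pP t; have [q1 q2] := qQ t.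
  by rewrite mderivD !pevalD derivD !hornerE p1 p2 q1 q2.
- exists (P * Q) => t; have [p1 p2] := pP t; have [q1 q2] := qQ t.
  by rewrite mderivM !(pevalD, pevalM) derivM !hornerE p1 p2 q1 q2.
- exists (c *: P) => t; have [p1 p2] := pP t.
  by rewrite mderivZ !pevalZ derivZ !hornerE p1 p2.
Qed.

Definition ball_int p : R :=
  \int[lebesgue_tuple R d]_(x in eball R d) peval p x.

Lemma measurable_eball : measurable (eball R d).
Proof. by rewrite eballE; exact: measurable_ballc. Qed.

Lemma integrable_peval p :
  (lebesgue_tuple R d).-integrable (eball R d) (EFin \o peval p).
Proof.
have [M pM] := peval_ball_bounded p.
by rewrite eballE; apply: integrable_ballc pM; exact: measurable_peval.
Qed.

Lemma ball_intD p q : ball_int (p + q) = ball_int p + ball_int q.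
Proof.
rewrite -RintegralD; [|exact: measurable_eball|exact: integrable_peval..].
by apply: eq_Rintegral => x _; rewrite pevalD.
Qed.

Lemma ball_intZ c p : ball_int (c *: p) = c * ball_int p.
Proof.
rewrite -RintegralZl; [|exact: measurable_eball|exact: integrable_peval].
by apply: eq_Rintegral => x _; rewrite pevalZ.
Qed.

Lemma ball_int_is_linear : linear_for *%R ball_int.
Proof. by move=> c p q; rewrite ball_intD ball_intZ. Qed.

HB.instance Definition _ :=
  GRing.isLinear.Build R {mpoly R[d]} R *%R ball_int ball_int_is_linear.

Lemma ball_intB p q : ball_int (p - q) = ball_int p - ball_int q.
Proof. exact: raddfB. Qed.

(** The factor [1 - S] supplies the vanishing on the sphere. *)
Lemma ball_int_deriv i q : ball_int (mderiv i ((1 - S) * q)) = 0.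
Proof.
have [M qM] := peval_ball_bounded (mderiv i ((1 - S) * q)).
rewrite /ball_int /Rintegral eballE (@integral_ballc_deriv _ _ i 1
  (peval ((1 - S) * q)) _ M) //.
- exact: measurable_peval.
- by move=> x; exact: peval_line.
- by move=> x x1; rewrite pevalM pevalB peval1 peval_sqnormX x1 subrr mul0r.
Qed.

Lemma ball_int_div (W : 'I_d -> {mpoly R[d]}) :
  ball_int (\sum_i mderiv i ((1 - S) * W i)) = 0.
Proof. by rewrite raddf_sum big1 // => i _; exact: ball_int_deriv. Qed.

(** On a monomial with exponents [m], each summand multiplies by [m i], and these exponents add up
    to [l]. *)
Lemma euler_identity p l : p \is l.-homog ->
  \sum_i Xm i * mderiv i p = l%:R *: p.
Proof.
move=> /dhomogP hp; rewrite [in RHS](mpolyE p) scaler_sumr.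
under eq_bigr => i _ do rewrite [in X in _ * X](mpolyE p) raddf_sum mulr_sumr.
rewrite exchange_big /= [LHS]big_seq [RHS]big_seq; apply: eq_bigr => m /hp <-.
rewrite -[X in X%:R]/(mdeg m) mdegE natr_sum scaler_suml; apply: eq_bigr => i _.
rewrite mderivZ -scalerAr [RHS]scalerA [X in _ = X *: _]mulrC -[RHS]scalerA; congr (_ *: _).
(* Exponents are subtracted with truncation; when [m i = 0] the coefficient vanishes anyway. *)
rewrite mderivX -scalerAr; case: (posnP (m i)) => [->|mi]; first by rewrite !scale0r.
by rewrite -mpolyXD addmC submK // lep1mP -lt0n.
Qed.

Lemma sqnormX_homog : S \is 2.-homog.
Proof.
apply: rpred_sum => i _; rewrite -[2%N]mul1n.
by apply: dhomogMn; rewrite dhomogX; apply/eqP; exact: mdeg1.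
Qed.

Lemma div_radial q e : q \is e.-homog ->
  \sum_i mderiv i (Xm i * q) = (d + e)%:R *: q.
Proof.
move=> hq; under eq_bigr => i _ do rewrite mderivM mderivXU eqxx mul1r.
by rewrite big_split /= (euler_identity hq) sumr_const card_ord natrD scalerDl
  !scaler_nat.
Qed.

(* The radial field x q (S ^+ m - 1) vanishes on the sphere. *)
Lemma ball_int_homog q e m : q \is e.-homog ->
  (d + e + m.*2)%:R * ball_int (q * S ^+ m) = (d + e)%:R * ball_int q.
Proof.
move=> hq.
have hqm : q * S ^+ m \is (e + m.*2).-homog.
  by apply: dhomogM => //; rewrite -mul2n; apply: dhomogMn; exact: sqnormX_homog.
apply/eqP; rewrite -subr_eq0 -addnA -!ball_intZ -ball_intB.
rewrite -(div_radial hqm) -(div_radial hq) -sumrB.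
(* The geometric sum [S ^+ m - 1 = (S - 1) * \sum_(k < m) S ^+ k] exhibits the factor [1 - S] that
   [ball_int_div] asks for. *)
rewrite -(@ball_int_div (fun i => - (Xm i * q * \sum_(k < m) S ^+ k))).
apply/eqP; congr ball_int; apply: eq_bigr => i _.
rewrite -mderivB; congr mderiv.
have := subrX1 S m; move: (\sum_(k < m) _) => W h.
transitivity (Xm i * q * (S ^+ m - 1)); first by ring.
by rewrite h; ring.
Qed.

End PolynomialCalculus.

(** * Moments of polynomials against half-integer powers of [1 + t] *)

Section SqrtWeight.
Context {R : realType}.
Local Notation leb := (@lebesgue_measure R).

Lemma continuous_sqrt1D n : continuous (fun t : R => Num.sqrt (1 + t) ^+ n).
Proof.
move=> t; apply: (@continuous_comp _ _ _ (fun t : R => Num.sqrt (1 + t))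
  (fun s => s ^+ n)); last exact: exprn_continuous.
apply: (@continuous_comp _ _ _ (fun t : R => 1 + t) Num.sqrt).
  by apply: continuousD; [exact: cst_continuous|exact: cvg_id].
exact: sqrt_continuous.
Qed.

(** The antiderivative [F] is differentiated only for [t > -1], where the square root is smooth; at
    the endpoints its continuity suffices. *)
Lemma integral_sqrt1D n :
  \int[leb]_(t in `[-1, 1]) (Num.sqrt (1 + t) ^+ n) =
    2 / n.+2%:R * Num.sqrt 2 ^+ n.+2 :> R.
Proof.
pose F (t : R) : R := 2 / n.+2%:R * Num.sqrt (1 + t) ^+ n.+2.
have cF : continuous F.
  move=> t; apply: cvgM; [exact: cvg_cst|exact: continuous_sqrt1D].
have dF (t : R) : -1 < t -> is_derive t 1 F (Num.sqrt (1 + t) ^+ n).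
  move=> t1; have t0 : 0 < 1 + t by lra.
  have ds : is_derive t 1 (fun t : R => Num.sqrt (1 + t))
      (2 * Num.sqrt (1 + t))^-1.
    have -> : (2 * Num.sqrt (1 + t))^-1 = (2 * Num.sqrt (1 + t))^-1 * 1 :> R.
      by rewrite mulr1.
    apply: (@is_derive1_comp _ Num.sqrt (fun t => 1 + t)).
    - exact: is_derive1_sqrt.
    - rewrite -[X in is_derive _ _ _ X]add0r.
      by apply: is_deriveD.
  have -> : F = (2 / n.+2%:R) *: (fun t : R => Num.sqrt (1 + t)) ^+ n.+2.
    apply/funext => s; rewrite /F /GRing.scale /=; congr (_ * _).
    by elim: (n.+2) => [|k IHk]; rewrite ?expr0 // !exprS IHk.
  have s0 : Num.sqrt (1 + t) != 0 by rewrite gt_eqF // sqrtr_gt0.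
  apply: is_derive_eq; rewrite /GRing.scale /= exprS.
  rewrite -mulr_natl; field.
  by rewrite s0 -natrD pnatr_eq0.
have N11 : -1 < 1 :> R by lra.
rewrite /Rintegral (@continuous_FTC2 _ _ F _ _ N11).
- rewrite -EFinB /= /F subrr sqrtr0 expr0n /= mulr0 subr0.
  by rewrite (_ : 1 + 1 = 2).
- by apply: continuous_subspaceT; exact: continuous_sqrt1D.
- split.
  + by move=> t; rewrite in_itv /= => /andP[t1 _]; have [] := dF t t1.
  + by apply: cvg_at_right_filter; exact: cF.
  + by apply: cvg_at_left_filter; exact: cF.
- move=> t; rewrite in_itv /= => /andP[t1 _].
  by rewrite derive1E; have [_ ->] := dF t t1.
Qed.

(** The weight is [(1 + t)^(k/2)]; powers of the square root keep the exponent a natural number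
    although [beta] may be a half-integer. *)
Definition sqrt_moment (k : nat) (h : {poly R}) : R :=
  \int[leb]_(t in `[-1, 1]) (h.[t] * Num.sqrt (1 + t) ^+ k).

Lemma integrable_sqrt_moment k (h : {poly R}) :
  leb.-integrable `[-1, 1] (EFin \o (fun t => h.[t] * Num.sqrt (1 + t) ^+ k)).
Proof.
apply: continuous_compact_integrable; first exact: segment_compact.
apply: continuous_subspaceT => t.
by apply: cvgM; [exact: continuous_horner|exact: continuous_sqrt1D].
Qed.

Lemma sqrt_moment_is_linear k : linear_for *%R (sqrt_moment k).
Proof.
move=> c p q; rewrite /sqrt_moment.
rewrite -RintegralZl //; last exact: integrable_sqrt_moment.
rewrite -RintegralD //; last 2 first.
- rewrite (_ : EFin \o _ = EFin \o (fun t => (c *: p).[t] * Num.sqrt (1 + t) ^+ k)).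
    exact: integrable_sqrt_moment.
  by apply/funext => t /=; rewrite hornerZ mulrA.
- exact: integrable_sqrt_moment.
by apply: eq_Rintegral => t _; rewrite !hornerE /=; ring.
Qed.

HB.instance Definition _ k :=
  GRing.isLinear.Build R {poly R} R *%R (sqrt_moment k)
    (sqrt_moment_is_linear k).

Lemma sqrt_moment_pow k m :
  sqrt_moment k ((1 + 'X) ^+ m) =
    2 ^+ m * (2 * Num.sqrt 2 ^+ k.+2 / (m.*2 + k).+2%:R).
Proof.
transitivity (\int[leb]_(t in `[-1, 1]) (Num.sqrt (1 + t) ^+ (m.*2 + k)) : R).
  apply: eq_Rintegral => t; rewrite inE /= in_itv /= => /andP[t1 _].
  rewrite horner_exp !hornerE exprD -mul2n exprM sqr_sqrtr //; lra.
rewrite integral_sqrt1D -2!addnS exprD -mul2n exprM sqr_sqrtr //.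
by rewrite mulrCA mulrA [in RHS]mulrA [in RHS]mulrAC; ring.
Qed.

(* The powers of 1 + X form a basis of {poly R}. *)
Lemma poly_pow1D_ext (L1 L2 : {poly R} -> R) :
  linear_for *%R L1 -> linear_for *%R L2 ->
  (forall m, L1 ((1 + 'X) ^+ m) = L2 ((1 + 'X) ^+ m)) -> L1 =1 L2.
Proof.
move=> lin1 lin2 eqL h.
pose l1 := GRing.isLinear.Build R {poly R} R *%R L1 lin1.
pose l2 := GRing.isLinear.Build R {poly R} R *%R L2 lin2.
pose M1 : {scalar {poly R}} := HB.pack L1 l1.
pose M2 : {scalar {poly R}} := HB.pack L2 l2.
have LZ (L : {scalar {poly R}}) c p : L (c *: p) = c * L p by exact: scalarZ.
change (M1 h = M2 h).
(* Taylor expansion at [-1]: [h] is its translate by [-1] composed with ['X + 1], and the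
   coefficients of the translate are those of [h] in powers of ['X + 1]. *)
rewrite -[h](@comp_polyXaddC_K R _ (- 1)) polyCN opprK comp_polyE.
rewrite !raddf_sum; apply: eq_bigr => m _.
by rewrite [LHS](LZ M1) [RHS](LZ M2) [in M1 _]addrC [in M2 _]addrC [M1 _]eqL.
Qed.

End SqrtWeight.

(** * Reduction of the inner product on the ball to one variable *)

Section RadialReduction.
Context {R : realType} {d : nat}.
Implicit Types (Y : {mpoly R[d]}) (f g h : {poly R}).
Local Notation Xm i := (mpolyX R (mnm1 i)).
Local Notation S := (@sqnormX R d).
Local Notation T := (2 *: S - 1).
Local Notation "l .-homog" := (@ishomog1 d R l mdeg) (at level 1).

Lemma mderiv_horner_alg (i : 'I_d) (p : {mpoly R[d]}) h :
  mderiv i (horner_alg p h) = horner_alg p h^`() * mderiv i p.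
Proof.
elim/poly_ind: h => [|h c IHh]; first by rewrite deriv0 !raddf0 mul0r.
rewrite derivD derivC addr0 derivM derivX mulr1.
rewrite !(rmorphD, rmorphM) /= !horner_algX horner_algC.
rewrite mderivD mderivM mderivZ mderiv1 IHh.
by rewrite scaler0 addr0 mulrDl mulrAC.
Qed.

Lemma mderiv_sqnormX (i : 'I_d) : mderiv i S = 2 * Xm i.
Proof.
rewrite raddf_sum (bigD1 i) //= big1 => [|j ji].
  by rewrite addr0 expr2 mderivM !mderivXU eqxx mul1r mulr1; ring.
by rewrite expr2 mderivM !mderivXU eq_sym (negbTE ji) mul0r mulr0 addr0.
Qed.

Lemma radial_argE : T = 2 * S - 1.
Proof. by rewrite scaler_nat mulr_natl. Qed.

Lemma mderiv_radial (i : 'I_d) h :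
  mderiv i (horner_alg T h) = 4 * horner_alg T h^`() * Xm i.
Proof.
rewrite mderiv_horner_alg; move: (horner_alg _ _) => A.
by rewrite mderivB mderivZ mderiv1 mderiv_sqnormX scaler_nat; ring.
Qed.

(** Since [1 - T = 2 (1 - S)], the factor [1 - t] of the interval corresponds to the factor
    [1 - |x|^2] of the ball. *)
Lemma radial_1BX h :
  horner_alg T ((1 - 'X) * h) = 2 * ((1 - S) * horner_alg T h).
Proof.
rewrite rmorphM rmorphB rmorph1 /= horner_algX; rewrite radial_argE; ring.
Qed.

Lemma radial_1DX h :
  horner_alg T (h * (1 + 'X)) = 2 * (S * horner_alg T h).
Proof.
rewrite rmorphM rmorphD rmorph1 /= horner_algX; rewrite radial_argE; ring.
Qed.

Lemma ball_int_natl (n : nat) (p : {mpoly R[d]}) :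
  ball_int (n%:R * p) = n%:R * ball_int p.
Proof. by rewrite -ball_intZ mulr_natl scaler_nat. Qed.

(** The proportionality factor of [ball_int_radial], as forced by the case [h = 1]. *)
Definition radial_const (l : nat) Y : R :=
  (d + l.*2)%:R * ball_int (Y ^+ 2) / (2 * Num.sqrt 2 ^+ (d + l.*2)).

(* Both sides are linear in h, so only h = (1 + X)^m matters; then
   h(2|x|^2 - 1) = 2^m |x|^(2m). *)
Lemma ball_int_radial Y l h : (2 <= d)%N -> Y \is l.-homog ->
  ball_int (horner_alg T h * Y ^+ 2) =
    radial_const l Y * sqrt_moment (d - 2 + l.*2) h.
Proof.
move=> d2 hY; move: h.
have kE : (d - 2 + l.*2).+2 = (d + l.*2)%N by rewrite -2!addSn -addn2 subnK.
apply: poly_pow1D_ext.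
- move=> c p q; rewrite -mul_polyC rmorphD rmorphM /= horner_algC mulrDl -mulrA mulr_algl.
  exact: ball_int_is_linear.
- move=> c p q; rewrite sqrt_moment_is_linear /=; ring.
move=> m; rewrite sqrt_moment_pow kE.
have -> : horner_alg T ((1 + 'X) ^+ m) * Y ^+ 2 = 2 ^+ m *: (Y ^+ 2 * S ^+ m).
  rewrite rmorphXn rmorphD rmorph1 /= horner_algX addrC subrK exprZn.
  by rewrite -scalerAl mulrC.
rewrite ball_intZ /radial_const.
have hY2 : Y ^+ 2 \is l.*2.-homog by rewrite -muln2; exact: dhomogMn.
(* The ball integral and the moment depend on [m] through the same factor [2 ^+ m] and the same
   denominator [d + l.*2 + m.*2]. *)
have := ball_int_homog m hY2.
have -> : (m.*2 + (d - 2 + l.*2)).+2 = (d + l.*2 + m.*2)%N.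
  by rewrite -2!addnS kE addnC.
have nz : (d + l.*2 + m.*2)%:R != 0 :> R.
  by rewrite pnatr_eq0 -lt0n -addnA ltn_addr // (leq_trans _ d2).
have s0 : Num.sqrt 2 ^+ (d + l.*2) != 0 :> R.
  by rewrite expf_neq0 // gt_eqF // sqrtr_gt0.
move: (_ + _)%:R nz (Num.sqrt 2 ^+ _) s0 (ball_int (Y ^+ 2 * _)) => e e0 s s0 I1.
move=> <-; field; rewrite s0 e0 //.
Qed.

(* With T = 2|x|^2 - 1, F = (1 - X) f and G = (1 - X) g, the functions
   (1 - |x|^2) u and (1 - |x|^2) v are F(T) Y / 2 and G(T) Y / 2. The dot product
   of their gradients is 2 F'(T) G'(T) (1 + T) Y^2 plus the divergence of
   F(T) G(T) Y grad Y / 4, because Y is harmonic; and that field vanishes on the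
   sphere, because F(1) = 0. Everything is multiplied by 4 in the proof, to stay
   with integer coefficients. *)
Lemma sobolev_ball_radial (lambda : R) kappa Y l f g : Y \is l.-homog ->
  laplacian Y = 0 ->
  sobolev_ball lambda kappa (horner_alg T f * Y) (horner_alg T g * Y) =
    ball_int (horner_alg T (lambda / 2 ^+ (kappa + 2) *:
        ((1 - 'X) ^+ (kappa + 2) * f * g)
      + 2 *: (((1 - 'X) * f)^`() * ((1 - 'X) * g)^`() * (1 + 'X))) * Y ^+ 2).
Proof.
move=> hY lapY; rewrite /sobolev_ball.
set F := (1 - 'X) * f; set G := (1 - 'X) * g.
pose phi := horner_alg T.
have phiZ c h : phi (c *: h) = c *: phi h.
  by rewrite /phi -mul_polyC rmorphM /= horner_algC mulr_algl.
rewrite rmorphD /= -/phi !phiZ [in RHS]mulrDl -!scalerAl ball_intD !ball_intZ.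
congr (_ + _).
  rewrite -[RHS]mulrA; congr (_ * _); rewrite -ball_intZ.
  apply: eq_Rintegral => x _; rewrite pevalZ; symmetry.
  (* Each factor [1 - 'X] contributes a 2; together they cancel the denominator under [lambda]. *)
  have -> : phi ((1 - 'X) ^+ (kappa + 2) * f * g) =
      2 ^+ (kappa + 2) *: ((1 - S) ^+ (kappa + 2) * phi f * phi g).
    rewrite /phi !rmorphM rmorphXn /=; have := radial_1BX 1.
    rewrite rmorph1 !mulr1 => ->; move: (horner_alg _ f) (horner_alg _ g) => A B.
    by rewrite -[in RHS]natrX scaler_nat -[RHS]mulr_natl natrX exprMn !mulrA.
  rewrite -scalerAl pevalZ mulKf ?expf_neq0 //.
  rewrite expr2 !pevalM peval_exp pevalB peval1 peval_sqnormX enorm_sqr; ring.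
transitivity (ball_int (\sum_i mderiv i ((1 - S) * (phi f * Y)) *
    mderiv i ((1 - S) * (phi g * Y)))).
  apply: eq_Rintegral => x _; rewrite peval_sum.
  by apply: eq_bigr => i _; rewrite pevalM.
apply: (mulfI (x := 4%:R)) => //; rewrite -!ball_int_natl.
(* Chosen so that [(1 - S) * W i] is the field [F(T) G(T) Y grad Y], the factor [1 - S] being taken
   out of [F(T)]. *)
pose W i := 2 * phi f * phi G * Y * mderiv i Y.
rewrite -[RHS]addr0 -(ball_int_div W) -ball_intD; congr ball_int.
have phiF : 2 * ((1 - S) * (phi f * Y)) = phi F * Y.
  by rewrite /phi radial_1BX; ring.
have phiG : 2 * ((1 - S) * (phi g * Y)) = phi G * Y.
  by rewrite /phi radial_1BX; ring.
have WE i : (1 - S) * W i = phi F * phi G * Y * mderiv i Y.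
  by rewrite /W /phi [horner_alg _ F]radial_1BX; ring.
have dX p i : 2 * mderiv i p = mderiv i (2 * p) :> {mpoly R[d]}.
  by rewrite !mulr_natl raddfMn.
(* The 16 comes from [grad T = 4 x] in both factors; the cross terms and the square of [grad Y] form
   the divergence, up to the Laplacian term. *)
transitivity (\sum_i (16 * (phi F^`() * phi G^`() * Y ^+ 2) * Xm i ^+ 2
    + mderiv i ((1 - S) * W i)
    - phi F * phi G * Y * mderiv i (mderiv i Y))).
  rewrite mulr_sumr; apply: eq_bigr => i _.
  transitivity ((2 * mderiv i ((1 - S) * (phi f * Y))) *
    (2 * mderiv i ((1 - S) * (phi g * Y)))); first by ring.
  rewrite !dX phiF phiG WE !mderivM !mderiv_radial -!/phi; ring.
rewrite sumrB big_split /= -!mulr_sumr -/(laplacian Y) lapY mulr0 subr0.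
(* The squares of the variables sum to [S], and [16 S = 8 (1 + T)]. *)
congr (_ + _); rewrite -/S /phi radial_1DX rmorphM /=; ring.
Qed.

End RadialReduction.

(** * The inner product on the interval as a moment *)

Section IntervalSide.
Context {R : realType}.

Lemma powR_half (x : R) k : 0 <= x -> x `^ (k%:R / 2) = Num.sqrt x ^+ k.
Proof.
by move=> x0; rewrite mulrC powRrM powR12_sqrt // powR_mulrn // sqrtr_ge0.
Qed.

(** With [k = d - 2 + l.*2], [beta] is [k / 2]; the extra power of [1 + t] in the derivative term
    goes into the polynomial. Halving turns [2 ^+ (kappa + 2)] into [2 ^+ (kappa + 3)] and cancels
    the 2 before the derivative term. *)
Lemma sobolev_interval_moment (lambda : R) kappa d l (f g : {poly R}) :
  (2 <= d)%N ->
  sobolev_interval lambda kappa (beta d l) f g =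
    sqrt_moment (d - 2 + l.*2) (lambda / 2 ^+ (kappa + 2) *:
        ((1 - 'X) ^+ (kappa + 2) * f * g)
      + 2 *: (((1 - 'X) * f)^`() * ((1 - 'X) * g)^`() * (1 + 'X))) / 2.
Proof.
move=> d2; set k := (_ + l.*2)%N.
have bE : beta d l = k%:R / 2 :> R.
  rewrite /beta /k natrD natrB // -muln2 natrM; lra.
have bE1 : beta d l + 1 = k.+2%:R / 2 :> R.
  by rewrite bE -addn2 natrD; field.
rewrite linearD !scalarZ mulrDl; congr (_ + _).
  rewrite (addnS kappa 2) exprS invfM [RHS]mulrAC; congr (_ * _); first by ring.
  apply: eq_Rintegral => t; rewrite inE /= in_itv /= => /andP[t1 _].
  rewrite bE powR_half; last lra.
  by rewrite !hornerE; ring.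
rewrite mulrAC divff // mul1r.
apply: eq_Rintegral => t; rewrite inE /= in_itv /= => /andP[t1 _].
rewrite bE1 powR_half; last lra.
rewrite -addn2 exprD sqr_sqrtr; last lra.
by rewrite !hornerE /=; ring.
Qed.

End IntervalSide.

(** * Harmonic polynomials and the indexing of the system *)

Section Harmonics.
Context {R : realType} {d : nat}.
Implicit Types (p q Y : {mpoly R[d]}).
Local Notation vec := (d.-tuple (measurableTypeR R)).
Local Notation Xm i := (mpolyX R (mnm1 i)).
Local Notation "l .-homog" := (@ishomog1 d R l mdeg) (at level 1).

Lemma peval_homog p l c (x y : vec) : p \is l.-homog ->
  (forall i, tnth y i = c * tnth x i) -> peval p y = c ^+ l * peval p x.
Proof.
move=> /dhomogP hp yx; rewrite /peval !mevalE mulr_sumr.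
rewrite !big_seq; apply: eq_bigr => m /hp <-.
rewrite mulrCA -[X in c ^+ X]/(mdeg m) mdegE expr_sum -big_split /=.
by congr (_ * _); apply: eq_bigr => i _; rewrite yx exprMn.
Qed.

(* A homogeneous polynomial whose square has zero integral over the ball
   vanishes at almost every point of the ball, hence on almost every ray, hence
   at almost every point of the sphere. *)
Lemma ball_int_sqr_neq0 Y l : Y \is l.-homog -> sphere_ip Y Y = 1 ->
  ball_int (Y ^+ 2) != 0.
Proof.
move=> hY Y1; apply/eqP => Y0.
pose N : set vec := eball R d `&` [set x | peval Y x != 0].
have mnz : measurable [set x : vec | peval Y x != 0].
  rewrite -[X in measurable X]setTI.
  rewrite (_ : [set x | _] = peval Y @^-1` (~` [set 0])); last first.
    by apply/seteqP; split=> x /= /eqP.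
  by apply: (measurable_peval Y) => //; exact: measurableC.
have mN : measurable N by apply: measurableI => //; exact: measurable_eball.
have N0 : lebesgue_tuple R d N = 0%E.
  have iY := integrable_peval (Y ^+ 2).
  have : (\int[lebesgue_tuple R d]_(x in eball R d) `|(peval (Y ^+ 2) x)%:E| = 0)%E.
    rewrite -[RHS](_ : (ball_int (Y ^+ 2))%:E = 0%E); last by rewrite Y0.
    rewrite /ball_int /Rintegral fineK; last first.
      exact: (integrable_fin_num measurable_eball iY).
    apply: eq_integral => x _; rewrite gee0_abs // lee_fin peval_exp.
    exact: sqr_ge0.
  move/(ae_eq_integral_abs _ measurable_eball _).1 => h.
  have [A [mA A0 NA]] := h (measurable_int _ iY).
  apply/eqP; rewrite eq_le measure_ge0 andbT -A0.
  apply: le_measure; rewrite ?inE // => x [xB /= Yx].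
  apply: NA => /= /(_ xB) [/eqP].
  by rewrite peval_exp sqrf_eq0 (negbTE Yx).
have : sphere_ip Y Y = 0; last by rewrite Y1; apply/eqP; exact: oner_neq0.
have mS : measurable (esphere R d).
  rewrite -[X in measurable X]setTI.
  rewrite (_ : esphere R d = @enorm R d @^-1` [set 1]) //.
  exact: measurable_enorm.
pose Z : set vec := esphere R d `&` [set x | peval Y x != 0].
have mZ : measurable Z by exact: measurableI.
(* Up to the factor [d] this is the volume of the cone over [Z], which lies in [N] because the value
   of [Y] at [radial x] is a multiple of that at [x]. *)
have Z0 : surface_measure R d Z = 0%E.
  apply/eqP; rewrite /= /surface_measure mule_eq0; apply/orP; right.
  rewrite eq_le measure_ge0 andbT -N0.
  have mC : measurable [set x : vec | 0 < enorm x <= 1 /\ Z (radial x)].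
    rewrite (_ : [set x | _] =
      [set x | 0 < enorm x <= 1] `&` (@radial R d @^-1` Z)) //.
    apply: measurableI; first exact: measurable_punctured.
    by rewrite -[X in measurable X]setTI; exact: measurable_radial.
  apply: le_measure; rewrite ?inE //.
  move=> x [/andP[x0 x1] [_ /= Yx]]; split => //=; apply: contraNneq Yx.
  rewrite (@peval_homog Y l (enorm x)^-1 x (radial x)) // => [->|i].
    by rewrite mulr0.
  by rewrite tnth_mktuple.
have mYY : measurable_fun (esphere R d)
    (fun x : vec => (peval Y x * peval Y x)%:E).
  apply: measurable_funTS; apply/measurable_EFinP.
  by apply: measurable_funM; exact: measurable_peval.
rewrite /sphere_ip /Rintegral (ae_eq_integral (cst 0%E)) ?integral0 ?mulr0 //.
exists Z; split => // x /= h; split.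
  by apply: contrapT => nx; apply: h.
apply/eqP => Yx; apply: h => _; by rewrite Yx mul0r.
Qed.

(* p and q are the real and imaginary parts of (x_i + sqrt(-1) x_j)^l. *)
Lemma harmonic_pow (i j : 'I_d) l : i != j -> exists p q : {mpoly R[d]},
  [/\ [/\ p \is l.-homog & q \is l.-homog],
      [/\ mderiv i p = mderiv j q & mderiv j p = - mderiv i q],
      forall k, k != i -> k != j -> mderiv k p = 0 /\ mderiv k q = 0
    & exists x : vec, peval p x = 1 ].
Proof.
move=> ij; pose x : vec := [tuple (k == i)%:R | k < d].
(* At the basis vector [x] the complex power is 1; the induction also needs its imaginary part to be
   0. *)
suff [p [q [h1 h2 h3 [px _]]]] : exists p q : {mpoly R[d]},
  [/\ [/\ p \is l.-homog & q \is l.-homog],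
      [/\ mderiv i p = mderiv j q & mderiv j p = - mderiv i q],
      forall k, k != i -> k != j -> mderiv k p = 0 /\ mderiv k q = 0
    & peval p x = 1 /\ peval q x = 0].
  by exists p, q; split => //; exists x.
elim: l => [|l [p [q [[hp hq] [cr1 cr2] h3 [px qx]]]]].
  exists 1, 0; split.
  - by split; [exact: dhomog1|exact: dhomog0].
  - by rewrite !mderiv1 !mderiv0 oppr0.
  - by move=> k _ _; rewrite mderiv1 mderiv0.
  - by rewrite peval1 peval0.
(* Real and imaginary parts after one more multiplication by [x_i + sqrt(-1) x_j]. *)
exists (Xm i * p - Xm j * q), (Xm j * p + Xm i * q).
have hX k : Xm k \is 1.-homog by rewrite dhomogX; apply/eqP; exact: mdeg1.
have hXM k r : r \is l.-homog -> Xm k * r \is l.+1.-homog.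
  by rewrite -add1n => hr; apply: dhomogM.
have [xi xj] : tnth x i = 1 /\ tnth x j = 0.
  by rewrite !tnth_mktuple eqxx eq_sym (negbTE ij).
split.
- by split; [apply: rpredB|apply: rpredD]; exact: hXM.
- rewrite !(mderivB, mderivD) !mderivM !mderivXU !eqxx [j == i]eq_sym (negbTE ij) /=.
  by rewrite cr1 cr2 !mul1r !mul0r; split; ring.
- move=> k ki kj; have [p0 q0] := h3 k ki kj.
  rewrite !(mderivB, mderivD) !mderivM !mderivXU (negbTE ki) (negbTE kj) p0 q0.
  by rewrite !mul0r !mulr0 !addr0 subr0.
by rewrite pevalB pevalD !pevalM !pevalX xi xj px qx; split; ring.
Qed.

(** By the Cauchy-Riemann equations the two second derivatives of the real part cancel. *)
Lemma homog_harmonic_neq0 l : (2 <= d)%N ->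
  exists2 p : {mpoly R[d]}, homog_harmonic l p & p != 0.
Proof.
move=> d2; pose i := Ordinal (ltnW d2); pose j := Ordinal d2.
have [//|p [q [[hp _] [cr1 cr2] h3 [x px]]]] := @harmonic_pow i j l.
exists p; last by apply/eqP => p0; move: px; rewrite p0 peval0 => /esym/eqP;
  rewrite oner_eq0.
split => //; rewrite /laplacian (bigD1 i) //= (bigD1 j) //= big1.
  by rewrite cr1 cr2 mderivN mderiv_comm addr0 subrr.
by move=> k /andP[ki kj]; rewrite (h3 k ki kj).1 mderiv0.
Qed.

(** Hides the transport of [nu] along [l + j.*2 - j.*2 = l]; the tag is recorded to tell indices
    apart. *)
Lemma Rsystem_index (a : nat -> nat) (Y : forall l, 'I_(a l) -> {mpoly R[d]})
    (q : nat -> nat -> {poly R}) l j (nu : 'I_(a l)) :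
  exists2 i : sysidx a, tag i = (l + j.*2)%N &
    Rsystem Y q i = horner_alg (2 *: sqnormX - 1) (q l j) * Y l nu.
Proof.
have [nu' nu'E] : exists nu' : 'I_(a (l + j.*2 - j.*2)%N),
    horner_alg (2 *: sqnormX - 1) (q (l + j.*2 - j.*2)%N j) * Y _ nu' =
    horner_alg (2 *: sqnormX - 1) (q l j) * Y l nu.
  by rewrite addnK; exists nu.
have jn : (j < ((l + j.*2)./2).+1)%N by rewrite ltnS halfD doubleK odd_double andbF add0n leq_addl.
by exists (existT _ (l + j.*2)%N (existT _ (Ordinal jn) nu')).
Qed.

End Harmonics.

Theorem proposition3p1 (R : realType) (d kappa : nat) (lambda : R)
    (a : nat -> nat) (Y : forall l : nat, 'I_(a l) -> {mpoly R[d]})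
    (q : nat -> nat -> {poly R}) :
  (2 <= d)%N ->
  0 < lambda ->
  (forall l, has_dim (homog_harmonic l : set {mpoly R[d]}) (a l)) ->
  (forall l, is_basis (homog_harmonic l) (Y l)) ->
  (forall l, orthonormal_family sphere_ip (Y l)) ->
  (forall l j, size (q l j) = j.+1) ->
  is_basis [set: {mpoly R[d]}] (Rsystem Y q) ->
  mutually_orthogonal (sobolev_ball lambda kappa) (Rsystem Y q) ->
  forall l j k : nat, j <> k ->
    sobolev_interval lambda kappa (beta d l) (q l j) (q l k) = 0.
Proof.
move=> d2 _ _ Ybasis Yortho _ _ Rortho l j k jk.
(* A nonzero harmonic polynomial of degree [l] exists, so its basis is not empty. *)
have [nu _] : exists nu : 'I_(a l), True.
  have [p hp p0] := @homog_harmonic_neq0 R d l d2.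
  have [_ _ /(_ p hp) [s [c pE]]] := Ybasis l.
  case: s pE => [|nu s] pE; last by exists nu.
  by move: p0; rewrite pE big_nil eqxx.
have [/(_ nu) [hY lapY] _ _] := Ybasis l.
have Y1 : sphere_ip (Y l nu) (Y l nu) = 1 by have [_] := Yortho l.
have [i1 n1 R1] := @Rsystem_index R d a Y q l j nu.
have [i2 n2 R2] := @Rsystem_index R d a Y q l k nu.
(* Their total degrees [l + j.*2] and [l + k.*2] differ. *)
have i12 : i1 != i2.
  apply/eqP => i12; apply: jk; apply: double_inj; apply/eqP.
  by rewrite -(eqn_add2l l) -n1 -n2 i12.
have C0 : radial_const l (Y l nu) != 0.
  apply: mulf_neq0; last first.
    by rewrite invr_eq0 mulf_neq0 // expf_neq0 // gt_eqF // sqrtr_gt0.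
  apply: mulf_neq0 (ball_int_sqr_neq0 hY Y1).
  by rewrite pnatr_eq0 -lt0n addn_gt0 (ltnW d2).
have := Rortho _ _ i12; rewrite R1 R2 (sobolev_ball_radial _ _ _ _ hY lapY).
rewrite (ball_int_radial _ d2 hY) sobolev_interval_moment // => /eqP.
by rewrite mulf_eq0 (negbTE C0) => /eqP ->; rewrite mul0r.
Qed.
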